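(* Let $(\mathcal{C},\mathcal{L})$ be a strict indexed symmetric monoidal category with a comprehension schema $(\mathbf{p},\mathbf{v})$. Let $\mathcal{I}$ be the full sub-indexed category of $\mathcal{C}/-$ (indexed via a choice of pullbacks) on the objects of the form $\mathbf{p}_{\Delta,A}$. Then the assignments $$M_\Delta(A\xrightarrow{a}B):=\ \mathbf{p}_{\Delta,A}\xrightarrow{\ \langle \mathbf{p}_{\Delta,A},\ a\{\mathbf{p}_{\Delta,A}\}\circ\mathbf{v}_{\Delta,A}\rangle\ }\mathbf{p}_{\Delta,B}$$ define a morphism of indexed categories $M:\mathcal{L}\to\mathcal{I}$.
   Context: A strict indexed symmetric monoidal category is a functor $\mathcal{L}:\mathcal{C}^{op}\to\mathrm{SMCat}$ into the category of small symmetric monoidal categories and strong monoidal functors, where $\mathcal{C}$ is a category with terminal object; write $-\{f\}:=\mathcal{L}(f)$. A comprehension schema consists of, for each $\Delta\in\mathcal{C}$ and $A\in\mathcal{L}(\Delta)$, a representation of the functor $(\mathcal{C}/\Delta)^{op}\to\mathrm{Set}$, $x\mapsto\mathcal{L}(\mathrm{dom}\,x)(I,A\{x\})$: a representing object $\mathbf{p}_{\Delta,A}:\Delta.A\to\Delta$ of $\mathcal{C}/\Delta$ and universal element $\mathbf{v}_{\Delta,A}\in\mathcal{L}(\Delta.A)(I,A\{\mathbf{p}_{\Delta,A}\})$. For $f:\Delta'\to\Delta$ and $a\in\mathcal{L}(\Delta')(I,A\{f\})$, $\langle f,a\rangle\in\mathcal{C}/\Delta(f,\mathbf{p}_{\Delta,A})$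 denotes the morphism corresponding to $a$ under the induced bijection. *)

(* Defs.v *)
From Corelib Require Import ssreflect ssrfun.
From Stdlib Require Import ProofIrrelevance.

Set Implicit Arguments.
Unset Strict Implicit.
Unset Printing Implicit Defensive.

Declare Scope cat_scope.
Delimit Scope cat_scope with cat.
Open Scope cat_scope.

Record Category := {
  ob :> Type;
  hom : ob -> ob -> Type;
  idm : forall x, hom x x;
  comp : forall x y z, hom y z -> hom x y -> hom x z;
  comp1m : forall x y (f : hom x y), comp (idm y) f = f;
  compm1 : forall x y (f : hom x y), comp f (idm x) = f;
  compA : forall x y z w (f : hom x y) (g : hom y z) (h : hom z w),
    comp h (comp g f) = comp (comp h g) f }.

Arguments hom {_} _ _.
Arguments idm {_} _.
Arguments comp {_} {_ _ _} _ _.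
Notation "g ∘ f" := (comp g f) (at level 40, left associativity) : cat_scope.

Definition is_iso (C : Category) (x y : C) (f : hom x y) : Prop :=
  exists g : hom y x, g ∘ f = idm x /\ f ∘ g = idm y.

Definition has_terminal (C : Category) : Prop :=
  exists t : C, forall x : C, exists h : hom x t, forall h' : hom x t, h' = h.

Definition eq_hom (C : Category) (x y : C) (e : x = y) : hom x y :=
  match e in _ = z return hom x z with eq_refl => idm x end.

Record FunctorData (C D : Category) := {
  fob :> C -> D;
  fmap : forall x y, hom x y -> hom (fob x) (fob y) }.

Arguments fmap {C D} F {x y} f : rename.

Record Functor (C D : Category) := {
  fdata :> FunctorData C D;
  fmap1 : forall x, fmap fdata (idm x) = idm (fdata x);
  fmapM : forall x y z (g : hom y z) (f : hom x y),
    fmap fdata (g ∘ f) = fmap fdata g ∘ fmap fdata f }.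

Definition functor_id (C : Category) : Functor C C.
Proof. by exists {| fob := fun x => x; fmap := fun x y f => f |}. Defined.

Definition functor_comp (C D E : Category) (G : Functor D E) (F : Functor C D) :
  Functor C E.
Proof.
exists {| fob := fun x => G (F x); fmap := fun x y f => fmap G (fmap F f) |}.
- by move=> x /=; rewrite !fmap1.
- by move=> x y z g f /=; rewrite !fmapM.
Defined.

Record NatIso (C D : Category) (F G : Functor C D) := {
  nat_at :> forall x, hom (F x) (G x);
  nat_natural : forall x y (f : hom x y), fmap G f ∘ nat_at x = nat_at y ∘ fmap F f;
  nat_iso : forall x, is_iso (nat_at x) }.

Definition full_sub (C : Category) (P : C -> Prop) : Category.
Proof.
exists {x : C | P x} (fun x y => hom (sval x) (sval y))
  (fun x => idm (sval x)) (fun x y z g f => g ∘ f).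
- by move=> *; exact: comp1m.
- by move=> *; exact: compm1.
- by move=> *; exact: compA.
Defined.

Record SliceOb (C : Category) (D : C) := { dom : C; arr :> hom dom D }.

Lemma slice_comp_subproof (C : Category) (D : C) (x y z : SliceOb D)
    (g : {h : hom (dom y) (dom z) | z ∘ h = y})
    (f : {h : hom (dom x) (dom y) | y ∘ h = x}) :
  z ∘ (sval g ∘ sval f) = x.
Proof. by case: g f => [g /= eg] [f /= ef]; rewrite compA eg. Qed.

Lemma slice_hom_eq (C : Category) (D : C) (x y : SliceOb D)
    (f g : {h : hom (dom x) (dom y) | y ∘ h = x}) :
  sval f = sval g -> f = g.
Proof.
case: f g => [f ef] [g eg] /= e; move: ef; rewrite e => ef.
by rewrite (proof_irrelevance _ ef eg).
Qed.

Definition slice (C : Category) (D : C) : Category.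
Proof.
exists (SliceOb D)
  (fun x y => {h : hom (dom x) (dom y) | y ∘ h = x})
  (fun x => exist (fun h => arr x ∘ h = x) (idm (dom x)) (compm1 x))
  (fun x y z g f => exist _ (sval g ∘ sval f) (slice_comp_subproof g f)).
- by move=> x y f; apply: slice_hom_eq; rewrite /= comp1m.
- by move=> x y f; apply: slice_hom_eq; rewrite /= compm1.
- by move=> x y z w f g h; apply: slice_hom_eq; rewrite /= compA.
Defined.

Record SymMonCat := {
  smc_cat :> Category;
  unit_ob : smc_cat;
  tens : smc_cat -> smc_cat -> smc_cat;
  tensm : forall x x' y y' : smc_cat,
    hom x x' -> hom y y' -> hom (tens x y) (tens x' y');
  assoc : forall x y z, hom (tens (tens x y) z) (tens x (tens y z));
  lunit : forall x, hom (tens unit_ob x) x;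
  runit : forall x, hom (tens x unit_ob) x;
  braid : forall x y, hom (tens x y) (tens y x);
  tensm1 : forall x y, tensm (idm x) (idm y) = idm (tens x y);
  tensmM : forall x x' x'' y y' y'' (f' : hom x' x'') (f : hom x x')
      (g' : hom y' y'') (g : hom y y'),
    tensm (f' ∘ f) (g' ∘ g) = tensm f' g' ∘ tensm f g;
  assoc_natural : forall x x' y y' z z' (f : hom x x') (g : hom y y') (h : hom z z'),
    assoc x' y' z' ∘ tensm (tensm f g) h = tensm f (tensm g h) ∘ assoc x y z;
  lunit_natural : forall x x' (f : hom x x'),
    lunit x' ∘ tensm (idm unit_ob) f = f ∘ lunit x;
  runit_natural : forall x x' (f : hom x x'),
    runit x' ∘ tensm f (idm unit_ob) = f ∘ runit x;
  braid_natural : forall x x' y y' (f : hom x x') (g : hom y y'),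
    braid x' y' ∘ tensm f g = tensm g f ∘ braid x y;
  assoc_iso : forall x y z, is_iso (assoc x y z);
  lunit_iso : forall x, is_iso (lunit x);
  runit_iso : forall x, is_iso (runit x);
  pentagon : forall w x y z,
    assoc w x (tens y z) ∘ assoc (tens w x) y z
    = tensm (idm w) (assoc x y z) ∘ assoc w (tens x y) z ∘ tensm (assoc w x y) (idm z);
  triangle : forall x y,
    tensm (idm x) (lunit y) ∘ assoc x unit_ob y = tensm (runit x) (idm y);
  hexagon : forall x y z,
    assoc y z x ∘ braid x (tens y z) ∘ assoc x y z
    = tensm (idm y) (braid x z) ∘ assoc y x z ∘ tensm (braid x y) (idm z);
  braidK : forall x y, braid y x ∘ braid x y = idm (tens x y) }.

Arguments unit_ob {_}.
Arguments tens {_} _ _.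
Arguments tensm {_} {_ _ _ _} _ _.
Arguments assoc {_} _ _ _.
Arguments lunit {_} _.
Arguments runit {_} _.
Arguments braid {_} _ _.

(* The braiding need not be preserved. *)
Record StrongMonFunctor (M N : SymMonCat) := {
  smf_functor :> Functor M N;
  smf_unit : hom (unit_ob : N) (smf_functor unit_ob);
  smf_tens : forall x y : M, hom (tens (smf_functor x) (smf_functor y)) (smf_functor (tens x y));
  smf_unit_iso : is_iso smf_unit;
  smf_tens_iso : forall x y, is_iso (smf_tens x y);
  smf_tens_natural : forall x x' y y' (f : hom x x') (g : hom y y'),
    smf_tens x' y' ∘ tensm (fmap smf_functor f) (fmap smf_functor g)
    = fmap smf_functor (tensm f g) ∘ smf_tens x y;
  smf_assoc : forall x y z,
    fmap smf_functor (assoc x y z) ∘ smf_tens (tens x y) z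
      ∘ tensm (smf_tens x y) (idm (smf_functor z))
    = smf_tens x (tens y z) ∘ tensm (idm (smf_functor x)) (smf_tens y z)
      ∘ assoc (smf_functor x) (smf_functor y) (smf_functor z);
  smf_lunit : forall x,
    fmap smf_functor (lunit x) ∘ smf_tens unit_ob x ∘ tensm smf_unit (idm (smf_functor x))
    = lunit (smf_functor x);
  smf_runit : forall x,
    fmap smf_functor (runit x) ∘ smf_tens x unit_ob ∘ tensm (idm (smf_functor x)) smf_unit
    = runit (smf_functor x) }.

Arguments smf_unit {M N} F : rename.
Arguments smf_tens {M N} F x y : rename.

Lemma is_iso_id (C : Category) (x : C) : is_iso (idm x).
Proof. by exists (idm x); rewrite comp1m. Qed.

Lemma is_iso_comp (C : Category) (x y z : C) (g : hom y z) (f : hom x y) :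
  is_iso g -> is_iso f -> is_iso (g ∘ f).
Proof.
move=> [g' [gK g'K]] [f' [fK f'K]]; exists (f' ∘ g'); split.
- by rewrite -compA (compA f g g') gK comp1m.
- by rewrite -compA (compA g' f' f) f'K comp1m.
Qed.

Lemma is_iso_fmap (C D : Category) (F : Functor C D) (x y : C) (f : hom x y) :
  is_iso f -> is_iso (fmap F f).
Proof. by move=> [g [gK fK]]; exists (fmap F g); rewrite -!fmapM gK fK !fmap1. Qed.

Definition smf_act (M N : SymMonCat) (F : StrongMonFunctor M N) (x : M)
    (a : hom unit_ob x) : hom unit_ob (F x) :=
  fmap F a ∘ smf_unit F.

Definition smf_id (M : SymMonCat) : StrongMonFunctor M M.
Proof.
exists (functor_id M) (idm unit_ob) (fun x y => idm (tens x y)).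
- exact: is_iso_id.
- by move=> x y; exact: is_iso_id.
- by move=> *; rewrite /= comp1m compm1.
- by move=> *; rewrite /= !tensm1 !comp1m !compm1.
- by move=> *; rewrite /= tensm1 !compm1.
- by move=> *; rewrite /= tensm1 !compm1.
Defined.

Definition smf_comp (M N P : SymMonCat) (G : StrongMonFunctor N P)
  (F : StrongMonFunctor M N) : StrongMonFunctor M P.
Proof.
exists (functor_comp G F) (fmap G (smf_unit F) ∘ smf_unit G)
  (fun x y => fmap G (smf_tens F x y) ∘ smf_tens G (F x) (F y)).
- by apply: is_iso_comp (smf_unit_iso G); apply: is_iso_fmap; exact: smf_unit_iso.
- move=> x y; apply: is_iso_comp (smf_tens_iso G _ _); apply: is_iso_fmap.
  exact: smf_tens_iso.
- move=> x x' y y' f g /=.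
  by rewrite -compA smf_tens_natural compA -fmapM smf_tens_natural fmapM compA.
- move=> x y z /=.
  have e1 : tensm (fmap G (smf_tens F x y) ∘ smf_tens G (F x) (F y)) (idm (G (F z)))
    = tensm (fmap G (smf_tens F x y)) (fmap G (idm (F z)))
      ∘ tensm (smf_tens G (F x) (F y)) (idm (G (F z))).
    by rewrite -tensmM fmap1 comp1m.
  have e2 : tensm (idm (G (F x))) (fmap G (smf_tens F y z) ∘ smf_tens G (F y) (F z))
    = tensm (fmap G (idm (F x))) (fmap G (smf_tens F y z))
      ∘ tensm (idm (G (F x))) (smf_tens G (F y) (F z)).
    by rewrite -tensmM fmap1 comp1m.
  rewrite e1 e2 -!compA.
  rewrite (compA _ _ (smf_tens G (F (tens x y)) (F z))) smf_tens_natural.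
  rewrite (compA _ _ (smf_tens G (F x) (F (tens y z)))) smf_tens_natural.
  rewrite !compA -!fmapM smf_assoc !fmapM -!compA.
  move: (smf_assoc G (F x) (F y) (F z)); rewrite -!compA => ->.
  by [].
- move=> x /=.
  have e : tensm (fmap G (smf_unit F) ∘ smf_unit G) (idm (G (F x)))
    = tensm (fmap G (smf_unit F)) (fmap G (idm (F x))) ∘ tensm (smf_unit G) (idm (G (F x))).
    by rewrite -tensmM fmap1 comp1m.
  rewrite e -(smf_lunit G) -(smf_lunit F) !fmapM -!compA.
  by rewrite (compA _ _ (smf_tens G _ _)) smf_tens_natural !compA.
- move=> x /=.
  have e : tensm (idm (G (F x))) (fmap G (smf_unit F) ∘ smf_unit G)
    = tensm (fmap G (idm (F x))) (fmap G (smf_unit F)) ∘ tensm (idm (G (F x))) (smf_unit G).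
    by rewrite -tensmM fmap1 comp1m.
  rewrite e -(smf_runit G) -(smf_runit F) !fmapM -!compA.
  by rewrite (compA _ _ (smf_tens G _ _)) smf_tens_natural !compA.
Defined.

Lemma eq_hom_iso (C : Category) (x y : C) (e : x = y) : is_iso (eq_hom e).
Proof. by case: y / e; exact: is_iso_id. Qed.

Lemma eq_hom_comp (C : Category) (x y z : C) (e : x = y) (e' : y = z) :
  eq_hom e' ∘ eq_hom e = eq_hom (etrans e e').
Proof. by case: z / e'; rewrite /= comp1m. Qed.

Lemma fmap_eq_hom (C D : Category) (F : Functor C D) (x y : C) (e : x = y) :
  fmap F (eq_hom e) = eq_hom (f_equal F e).
Proof. by case: y / e; exact: fmap1. Qed.

Lemma smf_act_eq (M N : SymMonCat) (F G : StrongMonFunctor M N) (e : F = G) (x : M)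
    (a : hom unit_ob x) :
  smf_act G a
  = eq_hom (f_equal (fun H : StrongMonFunctor M N => fob (fdata H) x) e) ∘ smf_act F a.
Proof. by case: G / e; rewrite /= comp1m. Qed.

(* A functor [C^op -> SMCat]: functoriality is a Leibniz equality of strong
   monoidal functors, so it covers their actions on objects and morphisms and
   their structure isomorphisms. *)
Record StrictIndexedSMC (C : Category) := {
  sfib : C -> SymMonCat;
  sre : forall x y : C, hom x y -> StrongMonFunctor (sfib y) (sfib x);
  sre_id : forall x : C, sre (idm x) = smf_id (sfib x);
  sre_comp : forall (x y z : C) (f : hom y z) (g : hom x y),
    sre (f ∘ g) = smf_comp (sre g) (sre f) }.

Arguments sfib {C} L x : rename.
Arguments sre {C} L {x y} f : rename.

Notation "A {{ f }}" := (fob (fdata (smf_functor (sre _ f))) A)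
  (at level 2, f at level 200, format "A {{ f }}") : cat_scope.

Section Comprehension.
Variables (C : Category) (L : StrictIndexedSMC C).

Lemma sre_idE (x : C) (A : sfib L x) : A = A{{idm x}}.
Proof. by rewrite sre_id. Qed.

Lemma sre_compE (x y z : C) (f : hom y z) (g : hom x y) (A : sfib L z) :
  A{{f}}{{g}} = A{{f ∘ g}}.
Proof. by rewrite sre_comp. Qed.

Lemma sre_sliceE (D : C) (A : sfib L D) (x y : SliceOb D) (h : @hom (slice D) x y) :
  A{{y}}{{sval h}} = A{{x}}.
Proof. by rewrite sre_compE (svalP h). Qed.

(* The functor [x |-> L(dom x)(I, A{x})] on [(C/D)^op], on objects and on
   morphisms; the latter reindexes along [h], precomposes with the unit
   isomorphism [I -> I{h}] and identifies [A{y}{h}] with [A{x}]. *)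
Definition elements (D : C) (A : sfib L D) (x : slice D) : Type :=
  hom (unit_ob : sfib L (dom x)) A{{arr x}}.

Definition elements_re (D : C) (A : sfib L D) (x y : slice D) (h : hom x y)
    (a : elements A y) : elements A x :=
  eq_hom (sre_sliceE A h) ∘ smf_act (sre L (sval h)) a.

Lemma elements_re_id (D : C) (A : sfib L D) (x : slice D) (a : elements A x) :
  elements_re (idm x) a = a.
Proof.
rewrite /elements_re /= (smf_act_eq (esym (sre_id L (dom x)))) compA eq_hom_comp.
rewrite (proof_irrelevance _ (etrans _ _) erefl) /= comp1m /smf_act /=.
by rewrite compm1.
Qed.

Lemma elements_re_comp (D : C) (A : sfib L D) (x y z : slice D) (h : hom y z)
    (k : hom x y) (a : elements A z) :
  elements_re (h ∘ k) a = elements_re k (elements_re h a).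
Proof.
rewrite /elements_re /= (smf_act_eq (esym (sre_comp L (sval h) (sval k)))).
rewrite compA eq_hom_comp /smf_act /= !fmapM fmap_eq_hom -!compA.
rewrite [in RHS]compA eq_hom_comp.
by congr (eq_hom _ ∘ _); exact: proof_irrelevance.
Qed.

(* [proj S A] and [var S A] are the representing object [p] and the universal
   element [v]; [pairing S A f a] is the morphism [<f, a>]. *)
Record ComprehensionSchema := {
  proj : forall D : C, sfib L D -> slice D;
  var : forall (D : C) (A : sfib L D), elements A (proj A);
  pairing : forall (D : C) (A : sfib L D) (f : slice D),
    elements A f -> hom f (proj A);
  pairingK : forall (D : C) (A : sfib L D) (f : slice D),
    cancel (@pairing D A f) (fun h : hom f (proj A) => elements_re h (var A));
  varK : forall (D : C) (A : sfib L D) (f : slice D),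
    cancel (fun h : hom f (proj A) => elements_re h (var A)) (@pairing D A f) }.

End Comprehension.

Arguments proj {C L} S {D} A : rename.
Arguments var {C L} S {D} A : rename.
Arguments pairing {C L} S {D} A f a : rename.

(* A pseudofunctor [C^op -> Cat]; morphisms are pseudonatural transformations.
   The [eq_hom]s only account for the unit and associativity laws of [C] holding
   up to propositional equality. *)
Record IndexedCat (C : Category) := {
  fib : C -> Category;
  re : forall x y : C, hom x y -> Functor (fib y) (fib x);
  re_id : forall x : C, NatIso (functor_id (fib x)) (re (idm x));
  re_comp : forall (x y z : C) (f : hom y z) (g : hom x y),
    NatIso (functor_comp (re g) (re f)) (re (f ∘ g));
  re_comp_idl : forall (x y : C) (f : hom x y) (A : fib y),
    re_comp (idm y) f A ∘ fmap (re f) (re_id y A)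
    = eq_hom (f_equal (fun k => re k A) (esym (comp1m f)));
  re_comp_idr : forall (x y : C) (f : hom x y) (A : fib y),
    re_comp f (idm x) A ∘ re_id x (re f A)
    = eq_hom (f_equal (fun k => re k A) (esym (compm1 f)));
  re_compA : forall (x y z w : C) (h : hom x y) (g : hom y z) (f : hom z w) (A : fib w),
    re_comp (f ∘ g) h A ∘ fmap (re h) (re_comp f g A)
    = eq_hom (f_equal (fun k => re k A) (compA h g f))
      ∘ (re_comp f (g ∘ h) A ∘ re_comp g h (re f A)) }.

Arguments fib {C} I x : rename.
Arguments re {C} I {x y} f : rename.
Arguments re_id {C} I x : rename.
Arguments re_comp {C} I {x y z} f g : rename.

Record IndexedMorphism (C : Category) (J K : IndexedCat C) := {
  mor_at :> forall x : C, Functor (fib J x) (fib K x);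
  mor_re : forall (x y : C) (f : hom x y),
    NatIso (functor_comp (mor_at x) (re J f)) (functor_comp (re K f) (mor_at y));
  mor_re_id : forall (x : C) (A : fib J x),
    mor_re (idm x) A ∘ fmap (mor_at x) (re_id J x A) = re_id K x (mor_at x A);
  mor_re_comp : forall (x y z : C) (f : hom y z) (g : hom x y) (A : fib J z),
    mor_re (f ∘ g) A ∘ fmap (mor_at x) (re_comp J f g A)
    = re_comp K f g (mor_at z A) ∘ (fmap (re K g) (mor_re f A) ∘ mor_re g (re J f A)) }.

Definition eq_nat (C D : Category) (F G : FunctorData C D) (e : F = G) (x : C) :
  hom (F x) (G x) := eq_hom (f_equal (fun H : FunctorData C D => H x) e).

Lemma eq_nat_natural (C D : Category) (F G : FunctorData C D) (e : F = G)
    (x y : C) (f : hom x y) :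
  fmap G f ∘ eq_nat e x = eq_nat e y ∘ fmap F f.
Proof. by case: G / e; rewrite /eq_nat /= comp1m compm1. Qed.

Definition natiso_of_eq (C D : Category) (F G : Functor C D)
    (e : fdata F = fdata G) : NatIso F G :=
  {| nat_at := eq_nat e;
     nat_natural := eq_nat_natural e;
     nat_iso := fun x => eq_hom_iso _ |}.

(* The underlying indexed category of a strict indexed symmetric monoidal
   category; its comparison isomorphisms are identities. *)
Definition indexed_of_strict (C : Category) (L : StrictIndexedSMC C) : IndexedCat C.
Proof.
refine {| fib := fun x => sfib L x; re := fun x y f => sre L f;
  re_id := fun x => @natiso_of_eq _ _ (functor_id (sfib L x)) (sre L (idm x))
    (f_equal (fun F : StrongMonFunctor _ _ => fdata F) (esym (sre_id L x)));
  re_comp := fun x y z f g =>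
    @natiso_of_eq _ _ (functor_comp (sre L g) (sre L f)) (sre L (f ∘ g))
    (f_equal (fun F : StrongMonFunctor _ _ => fdata F) (esym (sre_comp L f g))) |}.
- move=> x y f A; rewrite /= /eq_nat fmap_eq_hom eq_hom_comp.
  by congr eq_hom; exact: proof_irrelevance.
- move=> x y f A; rewrite /= /eq_nat eq_hom_comp.
  by congr eq_hom; exact: proof_irrelevance.
- move=> x y z w h g f A; rewrite /= /eq_nat fmap_eq_hom !eq_hom_comp.
  by congr eq_hom; exact: proof_irrelevance.
Defined.

(* A choice of pullbacks, along arbitrary morphisms, of the members of a class
   [P] of slice objects, such that the pulled back object is again in [P]: this
   is what makes the full subcategories of the [C/D] on [P] an indexed category.
   When [P] holds of everything, it is a choice of all pullbacks of [C], and
   [sub_slice] is the indexed category [C/-] itself. *)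
Record PullbackChoice (C : Category) (P : forall D : C, slice D -> Prop) := {
  pb : forall (D' D : C) (f : hom D' D), full_sub (@P D) -> full_sub (@P D');
  pb_top : forall (D' D : C) (f : hom D' D) (x : full_sub (@P D)),
    hom (dom (sval (pb f x))) (dom (sval x));
  pb_sq : forall (D' D : C) (f : hom D' D) (x : full_sub (@P D)),
    arr (sval x) ∘ pb_top f x = f ∘ arr (sval (pb f x));
  pb_lift : forall (D' D : C) (f : hom D' D) (x : full_sub (@P D)) (z : C)
      (h : hom z (dom (sval x))) (k : hom z D'),
    arr (sval x) ∘ h = f ∘ k -> hom z (dom (sval (pb f x)));
  pb_lift_top : forall (D' D : C) (f : hom D' D) (x : full_sub (@P D)) (z : C)
      (h : hom z (dom (sval x))) (k : hom z D') (e : arr (sval x) ∘ h = f ∘ k),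
    pb_top f x ∘ pb_lift e = h;
  pb_lift_arr : forall (D' D : C) (f : hom D' D) (x : full_sub (@P D)) (z : C)
      (h : hom z (dom (sval x))) (k : hom z D') (e : arr (sval x) ∘ h = f ∘ k),
    arr (sval (pb f x)) ∘ pb_lift e = k;
  pb_lift_uniq : forall (D' D : C) (f : hom D' D) (x : full_sub (@P D)) (z : C)
      (u v : hom z (dom (sval (pb f x)))),
    pb_top f x ∘ u = pb_top f x ∘ v ->
    arr (sval (pb f x)) ∘ u = arr (sval (pb f x)) ∘ v -> u = v }.

Section SubSlice.
Variables (C : Category) (P : forall D : C, slice D -> Prop) (ch : PullbackChoice P).

Lemma pb_fmap_subproof (D' D : C) (f : hom D' D) (x y : full_sub (@P D)) (h : hom x y) :
  arr (sval y) ∘ (sval h ∘ pb_top ch f x) = f ∘ arr (sval (pb ch f x)).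
Proof. by rewrite compA (svalP h) pb_sq. Qed.

Definition pb_fmap (D' D : C) (f : hom D' D) (x y : full_sub (@P D)) (h : hom x y) :
    hom (pb ch f x) (pb ch f y) :=
  exist _ (pb_lift ch (pb_fmap_subproof f h)) (pb_lift_arr ch (pb_fmap_subproof f h)).

Lemma pb_hom_eq (D' D : C) (f : hom D' D) (x : full_sub (@P D)) (z : full_sub (@P D'))
    (u v : hom z (pb ch f x)) :
  pb_top ch f x ∘ sval u = pb_top ch f x ∘ sval v -> u = v.
Proof.
move=> e; apply: slice_hom_eq; apply: pb_lift_uniq e _.
by rewrite (svalP u) (svalP v).
Qed.

Definition pb_functor (D' D : C) (f : hom D' D) : Functor (full_sub (@P D)) (full_sub (@P D')).
Proof.
exists {| fob := pb ch f; fmap := pb_fmap f |}.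
- by move=> x; apply: pb_hom_eq; rewrite /= pb_lift_top comp1m compm1.
- move=> x y z h g; apply: pb_hom_eq.
  by rewrite /= pb_lift_top compA pb_lift_top -!compA pb_lift_top.
Defined.

Lemma pb_id_subproof (D : C) (x : full_sub (@P D)) :
  arr (sval x) ∘ idm (dom (sval x)) = idm D ∘ arr (sval x).
Proof. by rewrite comp1m compm1. Qed.

Definition pb_id (D : C) : NatIso (functor_id (full_sub (@P D))) (pb_functor (idm D)).
Proof.
exists (fun x => exist _ (pb_lift ch (pb_id_subproof x)) (pb_lift_arr ch (pb_id_subproof x))).
- move=> x y h; apply: pb_hom_eq.
  by rewrite /= !compA !pb_lift_top comp1m -compA pb_lift_top compm1.
- move=> x.
  have e : arr (sval x) ∘ pb_top ch (idm D) x = arr (sval (pb ch (idm D) x)).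
    by rewrite pb_sq comp1m.
  exists (exist _ (pb_top ch (idm D) x) e); split.
  + by apply: slice_hom_eq; rewrite /= pb_lift_top.
  + by apply: pb_hom_eq; rewrite /= compA pb_lift_top comp1m compm1.
Defined.

Lemma pb_comp_subproof (D'' D' D : C) (f : hom D' D) (g : hom D'' D') (x : full_sub (@P D)) :
  arr (sval x) ∘ (pb_top ch f x ∘ pb_top ch g (pb ch f x))
  = f ∘ g ∘ arr (sval (pb ch g (pb ch f x))).
Proof. by rewrite compA pb_sq -compA pb_sq compA. Qed.

Definition pb_comp (D'' D' D : C) (f : hom D' D) (g : hom D'' D') :
  NatIso (functor_comp (pb_functor g) (pb_functor f)) (pb_functor (f ∘ g)).
Proof.
exists (fun x =>
  exist _ (pb_lift ch (pb_comp_subproof f g x)) (pb_lift_arr ch (pb_comp_subproof f g x))).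
- move=> x y h; apply: pb_hom_eq.
  rewrite /= !compA !pb_lift_top -!compA !pb_lift_top.
  by rewrite !compA pb_lift_top.
- move=> x.
  have e1 : arr (sval x) ∘ pb_top ch (f ∘ g) x = f ∘ (g ∘ arr (sval (pb ch (f ∘ g) x))).
    by rewrite pb_sq compA.
  have e2 := pb_lift_arr ch e1.
  exists (exist _ (pb_lift ch e2) (pb_lift_arr ch e2)); split.
  + apply: pb_hom_eq; rewrite /= compA pb_lift_top compm1.
    apply: (pb_lift_uniq (p := ch)).
    * by rewrite compA !pb_lift_top.
    * by rewrite compA pb_lift_arr -compA pb_lift_arr pb_sq.
  + by apply: pb_hom_eq; rewrite /= compA pb_lift_top -compA !pb_lift_top compm1.
Defined.

Lemma pb_top_eq_hom (D' D : C) (f g : hom D' D) (e : f = g) (x : full_sub (@P D)) :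
  pb_top ch g x ∘ sval (eq_hom (f_equal (fun k => pb_functor k x) e)) = pb_top ch f x.
Proof. by case: g / e; rewrite /= compm1. Qed.

Definition sub_slice : IndexedCat C.
Proof.
refine {| fib := fun D => full_sub (@P D); re := pb_functor;
  re_id := pb_id; re_comp := pb_comp |}.
- move=> D' D f x; apply: pb_hom_eq; rewrite pb_top_eq_hom /=.
  by rewrite compA pb_lift_top -compA pb_lift_top compA pb_lift_top comp1m.
- move=> D' D f x; apply: pb_hom_eq; rewrite pb_top_eq_hom /=.
  by rewrite compA pb_lift_top -compA pb_lift_top compm1.
- move=> D1 D2 D3 D4 h g f x; apply: pb_hom_eq.
  rewrite [RHS]compA pb_top_eq_hom /=.
  rewrite !compA !pb_lift_top -!compA !pb_lift_top.
  by rewrite !compA pb_lift_top.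
Defined.

End SubSlice.

Definition is_proj (C : Category) (L : StrictIndexedSMC C) (S : ComprehensionSchema L)
    (D : C) (x : slice D) : Prop :=
  exists A : sfib L D, x = proj S A.

Definition comprehension_data (C : Category) (L : StrictIndexedSMC C)
    (S : ComprehensionSchema L) (D : C) :
    FunctorData (sfib L D) (full_sub (@is_proj C L S D)) :=
  @Build_FunctorData (sfib L D) (full_sub (@is_proj C L S D))
    (fun A : sfib L D => exist (@is_proj C L S D) (proj S A) (ex_intro _ A erefl))
    (fun (A B : sfib L D) (a : hom A B) =>
       pairing S B (proj S A) (fmap (sre L (arr (proj S A))) a ∘ var S A)).

(* Main.v *)
From Corelib Require Import ssreflect ssrfun ssrbool.
From Stdlib Require Import ProofIrrelevance IndefiniteDescription.
Require Import Defs.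

Set Implicit Arguments.
Unset Strict Implicit.
Unset Printing Implicit Defensive.

(** A morphism into [p_A] is determined by its composite with [p_A] and by the
   reindexing of [v_A] along it. For [f : D' -> D] let [q] be the morphism
   [p_{A{f}} -> p_A] over [f] that classifies [v_{A{f}}]; representability of
   the elements of [A] and of [A{f}] makes the square over [f] a pullback. The
   coherence isomorphisms of [M] compare this pullback with the chosen one, and
   every equation is checked on universal elements. *)

(** * Morphisms compared across equal codomains *)

(** Reindexing is functorial only up to propositional equality of objects, so an element of
    $A\{f\}\{g\}$ and one of $A\{f\circ g\}$ have different types. This relation compares them and
    lets transports be dropped by transitivity. *)
Definition same_map (K : Category) (w x y : K) (a : hom w x) (b : hom w y) : Prop :=
  exists e : x = y, eq_hom e ∘ a = b.

Section SameMap.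
Variable K : Category.
Implicit Types w x y z : K.

Lemma same_map_refl w x (a : hom w x) : same_map a a.
Proof. by exists erefl; rewrite /= comp1m. Qed.

Lemma same_map_sym w x y (a : hom w x) (b : hom w y) : same_map a b -> same_map b a.
Proof. by case=> e; case: y / e b => b /= <-; exists erefl; rewrite /= !comp1m. Qed.

Lemma same_map_trans w x y z (a : hom w x) (b : hom w y) (c : hom w z) :
  same_map a b -> same_map b c -> same_map a c.
Proof.
move=> [e <-] [e' <-]; exists (etrans e e').
by rewrite -eq_hom_comp compA.
Qed.

(** By proof irrelevance, a transport along an equality of [x] with itself is the identity. *)
Lemma same_map_eq w x (a b : hom w x) : same_map a b -> a = b.
Proof. by case=> e <-; rewrite (proof_irrelevance _ e erefl) /= comp1m. Qed.

Lemma same_map_cast w x y (e : x = y) (a : hom w x) : same_map (eq_hom e ∘ a) a.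
Proof. by apply: same_map_sym; exists e. Qed.

End SameMap.

(** * Strong monoidal functors acting on morphisms out of the unit *)

Section SmfAct.
Variables M N : SymMonCat.

Lemma same_map_smf_act (F : StrongMonFunctor M N) (x y : M)
    (a : hom unit_ob x) (b : hom unit_ob y) :
  same_map a b -> same_map (smf_act F a) (smf_act F b).
Proof.
case=> e; case: y / e b => b /= <-; rewrite comp1m; exact: same_map_refl.
Qed.

Lemma smf_act_fun_eq (F G : StrongMonFunctor M N) (x : M) (a : hom unit_ob x) :
  F = G -> same_map (smf_act F a) (smf_act G a).
Proof. by move=> ->; exact: same_map_refl. Qed.

Lemma same_map_fmap (F G : StrongMonFunctor M N) (x y : M) (a : hom x y)
    (b : hom unit_ob (F x)) (c : hom unit_ob (G x)) :
  F = G -> same_map b c -> same_map (fmap F a ∘ b) (fmap G a ∘ c).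
Proof.
move=> e; case: G / e c => c /same_map_eq ->; exact: same_map_refl.
Qed.

Lemma smf_act_comp (F : StrongMonFunctor M N) (x y : M) (a : hom x y)
    (b : hom unit_ob x) :
  smf_act F (a ∘ b) = fmap F a ∘ smf_act F b.
Proof. by rewrite /smf_act fmapM compA. Qed.

End SmfAct.

(** * Pullback squares and choices of pullbacks *)

Definition is_pullback (C : Category) (D D' X Y : C) (p : hom X D) (f : hom D' D)
    (p' : hom Y D') (q : hom Y X) : Prop :=
  p ∘ q = f ∘ p' /\
  forall (z : C) (h : hom z X) (k : hom z D'), p ∘ h = f ∘ k ->
    exists u : hom z Y, [/\ q ∘ u = h, p' ∘ u = k &
      forall v : hom z Y, q ∘ v = h -> p' ∘ v = k -> v = u].

(** The inverse is the mediating morphism of the opposite comparison; being compatible with the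
    projections to [D'], it is also a morphism of the slice. *)
Lemma pullback_comparison_inverse (C : Category) (D D' X Y Z : C) (p : hom X D)
    (f : hom D' D) (p1 : hom Y D') (q1 : hom Y X) (p2 : hom Z D') (q2 : hom Z X)
    (u : hom Y Z) :
  is_pullback p f p1 q1 -> is_pullback p f p2 q2 ->
  q2 ∘ u = q1 -> p2 ∘ u = p1 ->
  exists v : hom Z Y, [/\ p1 ∘ v = p2, v ∘ u = idm Y & u ∘ v = idm Z].
Proof.
move=> [s1 univ1] [s2 univ2] qu pu.
have [v [qv pv _]] := univ1 _ _ _ s2.
exists v; split=> //.
(* Both [v ∘ u] and the identity mediate the cone given by the first square itself. *)
- have [t [_ _ ut]] := univ1 _ _ _ s1.
  have -> : v ∘ u = t by apply: ut; rewrite compA ?qv ?pv.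
  by apply/esym/ut; rewrite compm1.
- have [t [_ _ ut]] := univ2 _ _ _ s2.
  have -> : u ∘ v = t by apply: ut; rewrite compA ?qu ?pu.
  by apply/esym/ut; rewrite compm1.
Qed.

(** Indefinite description turns the existence of pullbacks, and then of mediating morphisms, into
    functions. *)
Lemma pullback_choice_of_exists (C : Category) (P : forall D : C, slice D -> Prop) :
  (forall (D' D : C) (f : hom D' D) (x : full_sub (@P D)),
     exists (y : full_sub (@P D')) (q : hom (dom (sval y)) (dom (sval x))),
       is_pullback (arr (sval x)) f (arr (sval y)) q) ->
  inhabited (PullbackChoice P).
Proof.
move=> ex.
pose c1 D' D f x := constructive_indefinite_description _ (ex D' D f x).
pose c2 D' D f x := constructive_indefinite_description _ (svalP (c1 D' D f x)).
have pbP D' D f x := svalP (c2 D' D f x).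
pose c3 D' D f x z h k e :=
  constructive_indefinite_description _ ((pbP D' D f x).2 z h k e).
constructor.
refine (@Build_PullbackChoice C P (fun D' D f x => sval (c1 D' D f x))
  (fun D' D f x => sval (c2 D' D f x)) (fun D' D f x => (pbP D' D f x).1)
  (fun D' D f x z h k e => sval (c3 D' D f x z h k e)) _ _ _).
- by move=> D' D f x z h k e; case: (svalP (c3 D' D f x z h k e)).
- by move=> D' D f x z h k e; case: (svalP (c3 D' D f x z h k e)).
- move=> D' D f x z u v qe pe; have [sq univ] := pbP D' D f x.
  (* Both [u] and [v] mediate the cone obtained by composing the square with [v]. *)
  have e : arr (sval x) ∘ (sval (c2 D' D f x) ∘ v) = f ∘ (arr (sval (sval (c1 D' D f x))) ∘ v).
    by rewrite !compA sq.
  have [t [_ _ ut]] := univ _ _ _ e.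
  by rewrite (ut u qe pe) (ut v).
Qed.

Lemma pb_is_pullback (C : Category) (P : forall D : C, slice D -> Prop)
    (ch : PullbackChoice P) (D' D : C) (f : hom D' D) (x : full_sub (@P D)) :
  is_pullback (arr (sval x)) f (arr (sval (pb ch f x))) (pb_top ch f x).
Proof.
split=> [|z h k e]; first exact: pb_sq.
exists (pb_lift ch e); split; [exact: pb_lift_top | exact: pb_lift_arr |].
move=> v qv pv; apply: (pb_lift_uniq (p := ch)).
- by rewrite pb_lift_top.
- by rewrite pb_lift_arr.
Qed.

(** * Functoriality of reindexing on elements *)

Section Reindexing.
Variables (C : Category) (L : StrictIndexedSMC C).

(** [sre_comp] is an equality of strong monoidal functors, so it also covers the unit isomorphisms
    hidden in [smf_act]. *)
Lemma smf_act_sre_comp (x y z : C) (f : hom y z) (g : hom x y) (A : sfib L z)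
    (a : hom unit_ob A) :
  same_map (smf_act (sre L (f ∘ g)) a) (smf_act (sre L g) (smf_act (sre L f) a)).
Proof.
apply: same_map_trans (smf_act_fun_eq a (sre_comp L f g)) _.
rewrite /smf_act /= fmapM compA; exact: same_map_refl.
Qed.

Lemma smf_act_sre_id (x : C) (A : sfib L x) (a : hom unit_ob A) :
  same_map (smf_act (sre L (idm x)) a) a.
Proof.
apply: same_map_trans (smf_act_fun_eq a (sre_id L x)) _.
rewrite /smf_act /= compm1; exact: same_map_refl.
Qed.

Lemma same_map_fmap_comp (x y z : C) (f : hom y z) (g : hom x y) (k : hom x z)
    (A B : sfib L z) (a : hom A B) (b : hom unit_ob A{{k}})
    (c : hom unit_ob A{{f}}{{g}}) :
  f ∘ g = k -> same_map b c ->
  same_map (fmap (sre L k) a ∘ b) (fmap (sre L g) (fmap (sre L f) a) ∘ c).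
Proof.
move=> e; case: k / e b => b.
(* Naming the composite functor makes the two-stage reindexing the action of one functor, equal to
   [sre L (f ∘ g)]. *)
exact: (@same_map_fmap _ _ _ (smf_comp (sre L g) (sre L f)) _ _ a b c
  (sre_comp L f g)).
Qed.

Lemma elements_re_same (D : C) (A : sfib L D) (x y : slice D) (h : hom x y)
    (a : elements A y) :
  same_map (elements_re h a) (smf_act (sre L (sval h)) a).
Proof. exact: same_map_cast. Qed.

End Reindexing.

(** * Morphisms into a comprehension *)

Section Comprehension.
Variables (C : Category) (L : StrictIndexedSMC C) (S : ComprehensionSchema L).

Local Notation p A := (arr (proj S A)).
Local Notation ext A := (dom (proj S A)).
Local Notation v A := (var S A).

(** This is the uniqueness half of representability: [h] and [k] become parallel morphisms of the
    slice, and [varK] recovers each from the element it classifies. *)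
Lemma hom_ext_eq (D : C) (A : sfib L D) (z : C) (h k : hom z (ext A)) :
  p A ∘ h = p A ∘ k ->
  same_map (smf_act (sre L h) (v A)) (smf_act (sre L k) (v A)) ->
  h = k.
Proof.
move=> e hk; pose x : slice D := Build_SliceOb (p A ∘ k).
pose h' : hom x (proj S A) := exist _ h e.
pose k' : hom x (proj S A) := exist _ k erefl.
suff : h' = k' by move=> /(f_equal sval).
rewrite -(varK h') -(varK k'); congr pairing.
apply: same_map_eq; apply: same_map_trans (elements_re_same h' _) _.
apply: same_map_trans hk _; exact: same_map_sym (elements_re_same k' _).
Qed.

Lemma pairing_same (D : C) (A : sfib L D) (x : slice D) (a : elements A x) :
  same_map (smf_act (sre L (sval (pairing S A x a))) (v A)) a.
Proof.
rewrite -[X in same_map _ X](@pairingK _ _ S _ _ _ a).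
exact: same_map_sym (elements_re_same _ _).
Qed.

(** * Projections are stable under pullback *)

(** The morphism $q$ over $f$. The cast moves $\mathbf{v}_{A\{f\}}$ from $A\{f\}\{\mathbf{p}\}$ to
    $A\{f\circ\mathbf{p}\}$, where [pairing] expects it. *)
Definition ext_lift (D' D : C) (f : hom D' D) (A : sfib L D) :
    hom (ext A{{f}}) (ext A) :=
  sval (pairing S A (Build_SliceOb (f ∘ p A{{f}}))
    (eq_hom (sre_compE f (p A{{f}}) A) ∘ v A{{f}})).

Lemma ext_lift_sq (D' D : C) (f : hom D' D) (A : sfib L D) :
  p A ∘ ext_lift f A = f ∘ p A{{f}}.
Proof. exact: (svalP (pairing S A (Build_SliceOb _) _)). Qed.

Lemma smf_act_ext_lift (D' D : C) (f : hom D' D) (A : sfib L D) :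
  same_map (smf_act (sre L (ext_lift f A)) (v A)) (v A{{f}}).
Proof.
apply: same_map_trans (pairing_same (x := Build_SliceOb _) _) _; exact: same_map_cast.
Qed.

Lemma smf_act_ext_lift_comp (D' D : C) (f : hom D' D) (A : sfib L D) (z : C)
    (h : hom z (ext A{{f}})) :
  same_map (smf_act (sre L (ext_lift f A ∘ h)) (v A)) (smf_act (sre L h) (v A{{f}})).
Proof.
apply: same_map_trans (smf_act_sre_comp _ _ _) _.
apply: same_map_smf_act; exact: smf_act_ext_lift.
Qed.

(** A cone [(h, k)] identifies $A\{\mathbf{p}_A\}\{h\}$ with $A\{f\}\{k\}$, so $\mathbf{v}_A$
    reindexed along [h] is an element of $A\{f\}$ over [k]; its pairing is the mediating
    morphism. *)
Lemma ext_lift_is_pullback (D' D : C) (f : hom D' D) (A : sfib L D) :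
  is_pullback (p A) f (p A{{f}}) (ext_lift f A).
Proof.
split=> [|z h k e]; first exact: ext_lift_sq.
have eA : A{{p A}}{{h}} = A{{f}}{{k}} by rewrite !sre_compE e.
pose u := pairing S A{{f}} (Build_SliceOb k) (eq_hom eA ∘ smf_act (sre L h) (v A)).
have pu : p A{{f}} ∘ sval u = k := svalP u.
have vu : same_map (smf_act (sre L (sval u)) (v A{{f}})) (smf_act (sre L h) (v A)).
  apply: same_map_trans (pairing_same (x := Build_SliceOb _) _) _; exact: same_map_cast.
exists (sval u); split=> //.
- apply: hom_ext_eq; first by rewrite compA ext_lift_sq -compA pu.
  exact: same_map_trans (smf_act_ext_lift_comp _) vu.
- move=> w qw pw; apply: hom_ext_eq; first by rewrite pw.
  apply: same_map_trans (same_map_sym vu); rewrite -qw.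
  exact: same_map_sym (smf_act_ext_lift_comp _).
Qed.

Lemma is_proj_pullback_choice : inhabited (PullbackChoice (is_proj S)).
Proof.
apply: pullback_choice_of_exists => D' D f [x [A e]] /=; move: e => ->.
exists (exist _ (proj S A{{f}}) (ex_intro _ A{{f}} erefl)), (ext_lift f A).
exact: ext_lift_is_pullback.
Qed.

(** * Functoriality of $M_\Delta$ and naturality in the fibre *)

Definition ext_map (D : C) (A B : sfib L D) (a : hom A B) : hom (ext A) (ext B) :=
  sval (fmap (comprehension_data S D) a).

Lemma ext_map_arr (D : C) (A B : sfib L D) (a : hom A B) : p B ∘ ext_map a = p A.
Proof. exact: (svalP (fmap (comprehension_data S D) a)). Qed.

Lemma smf_act_ext_map (D : C) (A B : sfib L D) (a : hom A B) :
  same_map (smf_act (sre L (ext_map a)) (v B)) (fmap (sre L (p A)) a ∘ v A).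
Proof. exact: pairing_same. Qed.

Lemma smf_act_ext_map_comp (D : C) (A B : sfib L D) (a : hom A B) (z : C)
    (h : hom z (ext A)) :
  same_map (smf_act (sre L (ext_map a ∘ h)) (v B))
    (fmap (sre L h) (fmap (sre L (p A)) a) ∘ smf_act (sre L h) (v A)).
Proof.
apply: same_map_trans (smf_act_sre_comp _ _ _) _.
rewrite -smf_act_comp; apply: same_map_smf_act; exact: smf_act_ext_map.
Qed.

(** The comparison isomorphisms of [indexed_of_strict L] are transports; this eliminates their
    images under $M$. *)
Lemma ext_map_eq_hom (D : C) (A B : sfib L D) (e : A = B) :
  same_map (smf_act (sre L (ext_map (eq_hom e))) (v B)) (v A).
Proof.
apply: same_map_trans (smf_act_ext_map _) _.
rewrite fmap_eq_hom; exact: same_map_cast.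
Qed.

Definition comprehension_functor (D : C) :
  Functor (sfib L D) (full_sub (@is_proj C L S D)).
Proof.
exists (comprehension_data S D).
- move=> A; apply: slice_hom_eq; apply: hom_ext_eq.
    by rewrite [LHS]ext_map_arr compm1.
  apply: same_map_trans (smf_act_ext_map _) _; rewrite fmap1 comp1m.
  exact: same_map_sym (smf_act_sre_id _).
- move=> A B E b a; apply: slice_hom_eq; apply: hom_ext_eq.
    by rewrite [LHS]ext_map_arr [RHS]compA [X in _ = X ∘ _]ext_map_arr [RHS]ext_map_arr.
  apply: same_map_trans (smf_act_ext_map _) _.
  apply: same_map_trans (same_map_sym (smf_act_ext_map_comp b (ext_map a))).
  (* Since [ext_map a] lies over [D], reindexing [b] along $\mathbf{p}_A$ is reindexing along
     $\mathbf{p}_B$ and then along [ext_map a]. *)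
  rewrite fmapM -compA; apply: same_map_fmap_comp (ext_map_arr a) _.
  exact: same_map_sym (smf_act_ext_map a).
Defined.

(** Both sides reindex $\mathbf{v}_B$ to [a], reindexed along the diagonal of the square over [f],
    composed with $\mathbf{v}_{A\{f\}}$. *)
Lemma ext_lift_natural (D' D : C) (f : hom D' D) (A B : sfib L D) (a : hom A B) :
  ext_map a ∘ ext_lift f A = ext_lift f B ∘ ext_map (fmap (sre L f) a).
Proof.
apply: hom_ext_eq.
  by rewrite !compA ext_map_arr !ext_lift_sq -compA ext_map_arr.
apply: same_map_trans (smf_act_ext_map_comp _ _) _.
apply: same_map_trans (same_map_sym (smf_act_ext_lift_comp _)).
apply: same_map_trans (same_map_sym (smf_act_ext_map _)).
(* The intermediate term reindexes [a] in one stage along the diagonal, which then factors the other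
   way round by [ext_lift_sq]. *)
apply: (@same_map_trans _ _ _ (B{{p A ∘ ext_lift f A}}) _ _
  (fmap (sre L (p A ∘ ext_lift f A)) a
     ∘ (eq_hom (sre_compE (p A) (ext_lift f A) A) ∘ smf_act (sre L (ext_lift f A)) (v A)))).
  apply: same_map_sym; apply: same_map_fmap_comp erefl _; exact: same_map_cast.
apply: same_map_fmap_comp; first by rewrite ext_lift_sq.
apply: same_map_trans (same_map_cast _ _) _; exact: smf_act_ext_lift.
Qed.

(** * Comparison with the chosen pullbacks, and coherence *)

Section PullbackComparison.
Variable ch : PullbackChoice (is_proj S).

Local Notation M := comprehension_functor.

Definition pb_comparison (D' D : C) (f : hom D' D) (A : sfib L D) :
    hom (M D' A{{f}}) (pb ch f (M D A)) :=
  exist _ (pb_lift ch (x := M D A) (ext_lift_sq f A))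
    (pb_lift_arr ch (x := M D A) (ext_lift_sq f A)).

Lemma pb_comparison_top (D' D : C) (f : hom D' D) (A : sfib L D) :
  pb_top ch f (M D A) ∘ sval (pb_comparison f A) = ext_lift f A.
Proof. exact: pb_lift_top. Qed.

Definition pb_comparison_natiso (D' D : C) (f : hom D' D) :
  NatIso (functor_comp (M D') (sre L f)) (functor_comp (pb_functor ch f) (M D)).
Proof.
exists (pb_comparison f).
- move=> A B a; apply: pb_hom_eq => /=.
  rewrite [LHS]compA pb_lift_top -compA [RHS]compA !pb_lift_top.
  exact: ext_lift_natural.
- move=> A.
  have [w [pw wu uw]] := pullback_comparison_inverse (ext_lift_is_pullback f A)
    (pb_is_pullback ch f (M D A)) (pb_comparison_top f A) (svalP (pb_comparison f A)).
  by exists (exist _ w pw); split; apply: slice_hom_eq.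
Defined.

Lemma ext_lift_id (D : C) (A : sfib L D) (e : A = A{{idm D}}) :
  ext_lift (idm D) A ∘ ext_map (eq_hom e) = idm (ext A).
Proof.
apply: hom_ext_eq; first by rewrite compA ext_lift_sq comp1m ext_map_arr compm1.
apply: same_map_trans (smf_act_ext_lift_comp _) _.
apply: same_map_trans (ext_map_eq_hom _) _.
exact: same_map_sym (smf_act_sre_id _).
Qed.

(** Both sides lie over [f ∘ g] and reindex $\mathbf{v}_A$ to $\mathbf{v}_{A\{f\}\{g\}}$. *)
Lemma ext_lift_comp (x y z : C) (f : hom y z) (g : hom x y) (A : sfib L z)
    (e : A{{f}}{{g}} = A{{f ∘ g}}) :
  ext_lift (f ∘ g) A ∘ ext_map (eq_hom e) = ext_lift f A ∘ ext_lift g A{{f}}.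
Proof.
apply: hom_ext_eq.
  by rewrite !compA !ext_lift_sq -!compA ext_map_arr ext_lift_sq.
apply: same_map_trans (smf_act_ext_lift_comp _) _.
apply: same_map_trans (ext_map_eq_hom _) _.
apply: same_map_sym; apply: same_map_trans (smf_act_ext_lift_comp _) _.
exact: smf_act_ext_lift.
Qed.

Definition comprehension_morphism :
  IndexedMorphism (indexed_of_strict L) (sub_slice ch).
Proof.
refine (@Build_IndexedMorphism C (indexed_of_strict L) (sub_slice ch)
  (fun D => M D) (fun D' D f => pb_comparison_natiso f) _ _).
(* A slice morphism into a chosen pullback is determined by its composite with [pb_top], which turns
   both coherence laws into equations between lifts [ext_lift]. *)
- move=> D A; apply: pb_hom_eq => /=.
  rewrite [LHS]compA !pb_lift_top; exact: ext_lift_id.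
- move=> x y z f g A; apply: pb_hom_eq => /=.
  rewrite [LHS]compA pb_lift_top [RHS]compA pb_lift_top -compA.
  rewrite [X in _ = _ ∘ X]compA pb_lift_top -compA pb_lift_top.
  rewrite [RHS]compA pb_lift_top; exact: ext_lift_comp.
Defined.

End PullbackComparison.

End Comprehension.

Theorem theorem7 (C : Category) (hC : has_terminal C) (L : StrictIndexedSMC C)
    (S : ComprehensionSchema L) :
  inhabited (PullbackChoice (is_proj S)) /\
  forall ch : PullbackChoice (is_proj S),
  exists M : IndexedMorphism (indexed_of_strict L) (sub_slice ch),
    forall D : C, fdata (M D) = comprehension_data S D.
Proof.
split; first exact: is_proj_pullback_choice.
(* The equation on [fdata] holds by computation, as [comprehension_functor] is built on
   [comprehension_data]. *)
by move=> ch; exists (comprehension_morphism ch).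
Qed.
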